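(* Let $m, n \in \mathbb{Z} \setminus \{0\}$ and let $\mathrm{BS}(m,n)$ be the Baumslag-Solitar group given by the presentation \[ \mathrm{BS}(m,n) = \langle a, b \mid b^{-1} a^m b = a^n \rangle . \] Then the conjugation quandle $\mathrm{Conj}(\mathrm{BS}(m,n))$ is infinitely generated, i.e. it is not finitely generated as a quandle.
   Context: A quandle is a non-empty set $Q$ with a binary operation $* : Q \times Q \to Q$ such that: (i) $x * x = x$ for all $x \in Q$; (ii) for all $x, y \in Q$ there exists a unique $z \in Q$ such that $x = z * y$, and this $z$ is denoted $x *^{-1} y$; (iii) $(x * y) * z = (x * z) * (y * z)$ for all $x, y, z \in Q$. For a group $G$, the conjugation quandle $\mathrm{Conj}(G)$ is the set $G$ with the operation $x * y = y^{-1}xy$ (so $x *^{-1} y = yxy^{-1}$). A quandle $Q$ is generated by a subset $S \subseteq Q$ if the smallest subset of $Q$ containing $S$ and closed under both $*$ and $*^{-1}$ is $Q$; $Q$ is finitely generated if it is generated by some finite subset. *)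

(* Defs.v *)
From HB Require Import structures.
From mathcomp Require Import all_boot all_order all_algebra.
From mathcomp Require Import boolp classical_sets functions cardinality.

Set Implicit Arguments.
Unset Strict Implicit.
Unset Printing Implicit Defensive.

Import GRing.Theory Num.Theory.

Local Open Scope classical_set_scope.
Local Open Scope quotient_scope.
Local Open Scope group_scope.

HB.mixin Record isQuandle (Q : Type) := {
  qop : Q -> Q -> Q;
  quandle_nonempty : [set: Q] !=set0;
  qopxx : forall x, qop x x = x;
  qop_divP : forall x y, exists! z, x = qop z y;
  qopD : forall x y z, qop (qop x y) z = qop (qop x z) (qop y z)
}.

#[short(type="quandleType")]
HB.structure Definition Quandle := {Q of isQuandle Q}.

Definition qdiv (Q : quandleType) (x y : Q) : Q := sval (cid (qop_divP x y)).

Lemma qdivK (Q : quandleType) (x y : Q) : qop (qdiv x y) y = x.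
Proof. by rewrite /qdiv; case: cid => z /= [xE _]; rewrite -xE. Qed.

Lemma qdiv_eq (Q : quandleType) (x y z : Q) : x = qop z y -> qdiv x y = z.
Proof. by rewrite /qdiv; case: cid => t /= [_ t_uniq] /t_uniq. Qed.

Definition quandle_closed (Q : quandleType) (M : set Q) : Prop :=
  forall x y, M x -> M y -> M (qop x y) /\ M (qdiv x y).

Definition quandle_generated_by (Q : quandleType) (S : set Q) : Prop :=
  smallest (@quandle_closed Q) S = [set: Q].

Definition finitely_generated (Q : quandleType) : Prop :=
  exists S : set Q, finite_set S /\ quandle_generated_by S.

Definition Conj (G : groupType) : Type := G.

Section ConjQuandle.
Variable G : groupType.
Implicit Types x y z : G.

Fact conj_nonempty : [set: Conj G] !=set0.
Proof. by exists (1 : G). Qed.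

Fact conj_opxx x : x ^ x = x.
Proof. by rewrite conjgE mulKg. Qed.

Fact conj_divP x y : exists! z, x = z ^ y.
Proof.
by exists (x ^ y^-1); split=> [|z ->]; rewrite ?conjgKV ?conjgK.
Qed.

Fact conj_opD x y z : (x ^ y) ^ z = (x ^ z) ^ (y ^ z).
Proof. by rewrite -conjJg. Qed.

(* The library's x ^ y is y^-1 * (x * y). *)
HB.instance Definition _ :=
  isQuandle.Build (Conj G) conj_nonempty conj_opxx conj_divP conj_opD.

End ConjQuandle.

Lemma conj_qdivE (G : groupType) (x y : Conj G) :
  qdiv x y = (y : G) * (x : G) * (y : G)^-1.
Proof. by apply: qdiv_eq; rewrite /qop /= conjgE -!mulgA mulVg mulg1 mulKg. Qed.

(* A letter (x, false) stands for the generator x and (x, true) for x^-1. *)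
Definition word (X : choiceType) : Type := seq (X * bool).

Definition wordX (X : choiceType) (x : X) (k : int) : word X :=
  nseq `|k|%N (x, (k < 0)%R).

Definition letter_inv (X : choiceType) (l : X * bool) : X * bool :=
  (l.1, ~~ l.2).

Definition word_inv (X : choiceType) (u : word X) : word X :=
  rev (map (@letter_inv X) u).

Section Presentation.
Variables (X : choiceType) (R : word X -> word X -> Prop).

(* R u v is read as the defining relation u = v. *)
Inductive pres_eq : word X -> word X -> Prop :=
| pres_refl u : pres_eq u u
| pres_sym u v : pres_eq u v -> pres_eq v u
| pres_trans u v w : pres_eq u v -> pres_eq v w -> pres_eq u w
| pres_cat u u' v v' :
    pres_eq u u' -> pres_eq v v' -> pres_eq (u ++ v) (u' ++ v')
| pres_cancel l : pres_eq [:: l; letter_inv l] [::]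
| pres_rel u v : R u v -> pres_eq u v.

Lemma pres_cancel_word u : pres_eq (u ++ word_inv u) [::].
Proof.
elim: u => [|l u IHu]; first exact: pres_refl.
rewrite /word_inv map_cons rev_cons -cats1 cat_cons catA.
apply: pres_trans (pres_cancel l).
rewrite -[[:: l; _]]/([:: l] ++ ([::] ++ [:: letter_inv l])) -cat1s.
exact/pres_cat/pres_cat/pres_refl/IHu/pres_refl.
Qed.

Lemma word_invK : involutive (@word_inv X).
Proof.
move=> u; rewrite /word_inv map_rev revK -map_comp map_id_in // => -[x e] _.
by rewrite /letter_inv /= negbK.
Qed.

Lemma pres_inv u v : pres_eq u v -> pres_eq (word_inv u) (word_inv v).
Proof.
move=> uv; have inv_l w : pres_eq (word_inv w ++ w) [::].
  by rewrite -{2}[w]word_invK; apply: pres_cancel_word.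
apply: (@pres_trans _ (word_inv u ++ (v ++ word_inv v))).
  rewrite -{1}[word_inv u]cats0.
  exact/pres_cat/pres_sym/pres_cancel_word/pres_refl.
rewrite catA -{2}[word_inv v]cat0s; apply: pres_cat (pres_refl _).
apply: pres_trans (inv_l u).
exact/pres_cat/pres_sym/uv/pres_refl.
Qed.

Definition pres_eqb : rel (word X) := fun u v => `[< pres_eq u v >].

Fact pres_eqb_refl : reflexive pres_eqb.
Proof. by move=> u; apply/asboolP/pres_refl. Qed.

Fact pres_eqb_sym : symmetric pres_eqb.
Proof. by move=> u v; apply/asboolP/asboolP => /pres_sym. Qed.

Fact pres_eqb_trans : transitive pres_eqb.
Proof.
by move=> v u w /asboolP uv /asboolP vw; apply/asboolP/(pres_trans uv vw).
Qed.

Canonical pres_equiv :=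
  EquivRel pres_eqb pres_eqb_refl pres_eqb_sym pres_eqb_trans.

(* The group with generating set X and defining relations R. *)
Definition presented : Type := {eq_quot pres_equiv}.

HB.instance Definition _ := Choice.on presented.

Definition pres_class (u : word X) : presented := \pi_({eq_quot pres_equiv}) u.

Definition pres_repr (g : presented) : word X := repr (g : {eq_quot pres_equiv}).

Lemma pres_classP u v : pres_class u = pres_class v <-> pres_eq u v.
Proof. by split=> [/eqmodP/asboolP //|uv]; apply/eqmodP/asboolP. Qed.

Lemma pres_reprK : cancel pres_repr pres_class.
Proof. by move=> g; rewrite /pres_class /pres_repr reprK. Qed.

Lemma pres_repr_class u : pres_eq (pres_repr (pres_class u)) u.
Proof. by apply/pres_classP; rewrite pres_reprK. Qed.

Definition pres_one : presented := pres_class [::].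
Definition pres_mul (g h : presented) : presented :=
  pres_class (pres_repr g ++ pres_repr h).
Definition pres_invg (g : presented) : presented :=
  pres_class (word_inv (pres_repr g)).

Lemma pres_mulE u v :
  pres_mul (pres_class u) (pres_class v) = pres_class (u ++ v).
Proof. by apply/pres_classP/pres_cat; apply: pres_repr_class. Qed.

Lemma pres_invE u : pres_invg (pres_class u) = pres_class (word_inv u).
Proof. exact/pres_classP/pres_inv/pres_repr_class. Qed.

Fact pres_mulgA : associative pres_mul.
Proof.
move=> g h k; rewrite -[g]pres_reprK -[h]pres_reprK -[k]pres_reprK.
by rewrite !pres_mulE catA.
Qed.

Fact pres_mul1g : left_id pres_one pres_mul.
Proof. by move=> g; rewrite -[g]pres_reprK pres_mulE. Qed.

Fact pres_mulg1 : right_id pres_one pres_mul.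
Proof. by move=> g; rewrite -[g]pres_reprK pres_mulE cats0. Qed.

Fact pres_mulgV : right_inverse pres_one pres_invg pres_mul.
Proof.
move=> g; rewrite -[g]pres_reprK pres_invE pres_mulE.
exact/pres_classP/pres_cancel_word.
Qed.

Fact pres_mulVg : left_inverse pres_one pres_invg pres_mul.
Proof.
move=> g; rewrite -[g]pres_reprK pres_invE pres_mulE.
by apply/pres_classP; rewrite -{2}[pres_repr g]word_invK; apply: pres_cancel_word.
Qed.

HB.instance Definition _ := isGroup.Build presented
  pres_mulgA pres_mul1g pres_mulg1 pres_mulVg pres_mulgV.

Definition pres_gen (x : X) : presented := pres_class [:: (x, false)].

Definition word_eval (H : groupType) (f : X -> H) (u : word X) : H :=
  \prod_(l <- u) (if l.2 then (f l.1)^-1 else f l.1).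

Lemma word_eval_gen u : word_eval pres_gen u = pres_class u.
Proof.
elim: u => [|[x e] u IHu]; first by rewrite /word_eval big_nil.
rewrite /word_eval big_cons [X in _ * X]IHu.
rewrite -[in RHS]cat1s -[RHS]pres_mulE; congr (_ * _).
by case: e => //=; rewrite [LHS]pres_invE.
Qed.

Lemma pres_universal (H : groupType) (f : X -> H) :
    (forall u v, R u v -> word_eval f u = word_eval f v) ->
  exists! phi : presented -> H,
    {morph phi : g h / g * h} /\ forall x, phi (pres_gen x) = f x.
Proof.
move=> fR; pose phi g := word_eval f (pres_repr g).
have fP u v : pres_eq u v -> word_eval f u = word_eval f v.
  elim=> {u v} [//|u v _ -> //|u v w _ -> _ -> //|u u' v v' _ E1 _ E2|[x e]|//].
    by rewrite /word_eval !big_cat /= -!/(word_eval _ _) E1 E2.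
  by rewrite /word_eval !big_cons big_nil mulg1; case: e; rewrite /= ?mulVg ?mulgV.
have phiE u : phi (pres_class u) = word_eval f u by apply/fP/pres_repr_class.
have phiM : {morph phi : g h / g * h}.
  move=> g h; rewrite -[g]pres_reprK -[h]pres_reprK [_ * _]pres_mulE !phiE.
  by rewrite /word_eval big_cat.
exists phi; split=> [|psi [psiM psiX]].
  by split=> // x; rewrite phiE /word_eval big_cons big_nil mulg1.
apply/funext => g; rewrite -[g]pres_reprK phiE -word_eval_gen.
have psi1 : psi 1 = 1 by apply: (mulIg (psi 1)); rewrite -psiM !mul1g.
have psiV h : psi h^-1 = (psi h)^-1.
  by apply: (mulIg (psi h)); rewrite -psiM !mulVg.
rewrite /word_eval (big_morph psi psiM psi1).
by apply: eq_bigr => -[x e] _ /=; case: e; rewrite ?psiV psiX.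
Qed.

End Presentation.

Lemma word_evalX (X : choiceType) (H : groupType) (f : X -> H) (x : X) (k : int) :
  word_eval f (wordX x k) =
    if (k < 0)%R then f x ^- `|k|%N else f x ^+ `|k|%N.
Proof.
have E e n : word_eval f (nseq n (x, e)) = (if e then (f x)^-1 else f x) ^+ n.
  elim: n => [|n IHn]; first by rewrite /word_eval big_nil.
  by rewrite /word_eval big_cons [X in _ * X]IHn expgS.
by rewrite E; case: ifP => // _; rewrite expVgn.
Qed.

Definition BS_a : bool := false.
Definition BS_b : bool := true.

(* The single defining relation b^-1 a^m b = a^n. *)
Variant BS_rel (m n : int) : word bool -> word bool -> Prop :=
  BSRel : BS_rel m n (wordX BS_b (-1)%R ++ wordX BS_a m ++ wordX BS_b 1%R)
                     (wordX BS_a n).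

Definition BS (m n : int) : groupType := presented (BS_rel m n).

Lemma BS_relation (m n : int) (x := pres_gen (BS_rel m n)) (a := x BS_a)
    (b := x BS_b) (pow := fun (g : BS m n) (k : int) =>
      if (k < 0)%R then g ^- `|k|%N else g ^+ `|k|%N) :
  b^-1 * pow a m * b = pow a n.
Proof.
have := pres_rel (BSRel m n) => /pres_classP; rewrite -!word_eval_gen.
by rewrite {1}/word_eval !big_cat /= -!/(word_eval _ _) !word_evalX mulgA.
Qed.

(* Main.v *)
Require Import Defs.
From mathcomp Require Import all_boot all_order all_algebra.
From HB Require Import structures.
From mathcomp Require Import boolp classical_sets functions cardinality.

(** The quandle operations of [Conj G] replace an element by one of its
conjugates, so a subquandle generated by [S] only meets the conjugacy classes
that [S] meets. A finitely generated [Conj G] therefore forces every class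
function on [G] to take finitely many values ([class_fun_finite_range]).
Sending [a] to [0] and [b] to [1] respects the relation [b^-1 a^m b = a^n],
hence defines a homomorphism from [BS m n] to the integers
([BS_exponent_sum]); since the integers are abelian it is a class function,
and its values at the powers of [b] are pairwise distinct. *)

Set Implicit Arguments.
Unset Strict Implicit.
Unset Printing Implicit Defensive.

Import GRing.Theory.

Local Open Scope classical_set_scope.
Local Open Scope group_scope.

(** The additive group of the integers, written multiplicatively, on an alias
of [int] that keeps the two notations apart: its identity [1] is the integer
[0], and the integer one is written [1%R : int]. *)
Definition int_mul : Type := int.

HB.instance Definition _ := Choice.on int_mul.
HB.instance Definition _ := isGroup.Build int_mul
  (@addrA int) (@add0r int) (@addr0 int) (@addNr int) (@addrN int).

Lemma int_mul_expg (z : int_mul) (k : nat) : z ^+ k = ((z : int) *+ k)%R.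
Proof. by elim: k => // k IHk; rewrite expgS mulrS -IHk. Qed.

Lemma class_fun_finite_range (G : groupType) (T : Type) (f : G -> T) :
    (forall x y : G, f (x ^ y) = f x) ->
  finitely_generated (Conj G) -> finite_set (range f).
Proof.
move=> fJ [S [Sfin Sgen]].
apply: sub_finite_set (finite_image f Sfin) => _ [x _ <-].
have: smallest (@quandle_closed (Conj G)) S x by rewrite Sgen.
(* The elements on which [f] takes a value in [f @` S] form a subquandle. *)
move=> /(_ (f @^-1` (f @` S))); apply; split=> [y z|y Sy]; last by exists y.
move=> fSy _; rewrite /preimage /= conj_qdivE.
split; first by rewrite -[qop y z]/((y : G) ^ (z : G)) fJ.
by rewrite -mulgA -{1}[z : G]invgK -conjgE fJ.
Qed.

Lemma BS_exponent_sum (m n : int) :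
  exists phi : BS m n -> int_mul,
    {morph phi : g h / g * h} /\ phi (pres_gen (BS_rel m n) BS_b) = (1%R : int).
Proof.
pose f (x : bool) : int_mul := if x then (1%R : int) : int_mul else 1.
have [u v [] | phi [[phiM phiE] _]] := @pres_universal _ (BS_rel m n) _ f.
  have fa k : word_eval f (wordX BS_a k) = 1.
    by rewrite word_evalX /= expg1n invg1 if_same.
  rewrite fa /word_eval !big_cat /= -!/(word_eval _ _) fa !word_evalX /=.
  by rewrite mul1g mulVg.
by exists phi; rewrite phiE.
Qed.

Theorem theorem4p2 (m n : int) (hm : m <> 0%R) (hn : n <> 0%R) :
  ~ finitely_generated (Conj (BS m n)).
Proof.
have [phi [phiM phib]] := BS_exponent_sum m n.
set b := pres_gen _ BS_b in phib.
have phiJ (x y : BS m n) : phi (x ^ y) = phi x.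
  by apply: (mulgI (phi y)); rewrite -phiM conjgE mulVKg phiM; apply: addrC.
have phi1 : phi 1 = 1 by apply: (mulIg (phi 1)); rewrite -phiM !mul1g.
have phibX (k : nat) : phi ((b : BS m n) ^+ k) = (k%:R%R : int).
  suff -> : phi ((b : BS m n) ^+ k) = phi b ^+ k by rewrite int_mul_expg phib.
  by elim: k => // k IHk; rewrite !expgS phiM IHk.
move=> /(class_fun_finite_range phiJ) phi_fin; apply: infinite_nat.
apply: (sub_finite_set _ (@finite_preimage _ _ _
          (fun k => phi ((b : BS m n) ^+ k)) _ phi_fin)).
  by move=> k _; exists ((b : BS m n) ^+ k).
by move=> j k _ _; rewrite !phibX !natz => -[].
Qed.
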